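(* For every fixed integer $k\ge 1$ there is an online coloring algorithm, using colors from $\{1,2,3,\ldots\}$ and depending only on $k$, that colors any countable sequence $p_1,p_2,\ldots$ of points in the plane such that for every positive integer $c$ and every $n<2^{(k-1)\lceil (c-3)/4\rceil+1}-1$, the first $n$ points of the sequence are $k$-properly $c$-colored (with the colors $1,\dots,c$).
   Context: A wedge is a set $\{(x,y)\in\mathbb{R}^2 : x<x_0,\ y<y_0\}$ with fixed apex $(x_0,y_0)$, where $x_0=\infty$ and $y_0=\infty$ are also allowed. A finite set of colored points in the plane is $k$-properly $c$-colored if at most $c$ colors are used and every wedge containing at least $k$ points of the set contains two points of the set of different colors. An online coloring algorithm is a (deterministic) rule that, when distinct points $p_1,p_2,\ldots$ of the plane arrive one at a time, assigns to $p_i$ on its arrival a color, knowing only $p_1,\ldots,p_i$ and the colors of $p_1,\dots,p_{i-1}$; colors are never changed later, and nothing is known about future points (in particular neither the total number of points nor the parameter $c$ is given to the algorithm). *)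

(* Defs.v *)
From HB Require Import structures.
From mathcomp Require Import all_boot all_order all_algebra.
From mathcomp Require Import reals constructive_ereal.

Set Implicit Arguments.
Unset Strict Implicit.
Unset Printing Implicit Defensive.

Import Order.TTheory GRing.Theory Num.Theory.

Definition plane (R : realType) : Type := (R * R)%type.

(* Apex coordinates range over [\bar R]; only [+oo] is an admissible infinite
   value, and [-oo] is excluded in [properly_colored]. *)
Definition wedge (R : realType) (x0 y0 : \bar R) (q : plane R) : bool :=
  ((q.1)%:E < x0)%E && ((q.2)%:E < y0)%E.

(* A finite set of colored points is a list of (point, color) pairs whose
   points are pairwise distinct, so that [count] below is a cardinality. *)
Definition colored_points (R : realType) : Type := seq (plane R * nat).

Definition properly_colored (R : realType) (k c : nat) (s : colored_points R) :
    Prop :=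
  (size (undup (unzip2 s)) <= c)%N /\
  forall x0 y0 : \bar R, x0 != -oo%E -> y0 != -oo%E ->
    (k <= count (fun z => wedge x0 y0 z.1) s)%N ->
    exists z1 z2, [/\ z1 \in s, z2 \in s,
      wedge x0 y0 z1.1, wedge x0 y0 z2.1 & z1.2 != z2.2].

(* The rule sees the earlier points with their colors, in order of arrival,
   and the new point. *)
Definition online_rule (R : realType) : Type :=
  colored_points R -> plane R -> nat.

Definition run (R : realType) (A : online_rule R) (ps : seq (plane R)) :
    colored_points R :=
  foldl (fun h q => rcons h (q, A h q)) [::] ps.

(* A countable sequence is a pair of [p : nat -> plane R] and a length
   [L : option nat], where [None] means infinite; the terms of the sequence are
   the [p i] with [in_length L i], indexed from 0. *)
Definition in_length (L : option nat) (i : nat) : bool :=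
  if L is Some l then (i < l)%N else true.

Definition distinct_points (R : realType) (L : option nat) (p : nat -> plane R) :
    Prop :=
  forall i j, in_length L i -> in_length L j -> p i = p j -> i = j.

(* Main.v *)
Require Import Defs.
From HB Require Import structures.
From mathcomp Require Import all_boot all_order all_algebra.
From mathcomp Require Import boolp reals constructive_ereal.
From mathcomp Require Import zify lra.

Set Implicit Arguments.
Unset Strict Implicit.
Unset Printing Implicit Defensive.

Import Order.TTheory GRing.Theory Num.Theory.
Local Open Scope ring_scope.

(** The colors are grouped into levels of four, level [l] consisting of
    [4l+1, ..., 4l+4]. A color [a] is blocked at strength [s] for a new point
    [q] if some wedge around [q] contains more than [s] earlier points, all of
    color [a]. The pairs (level [l], strength [s < k-1]), ordered
    lexicographically, are numbered by [t = l (k-1) + s]; the rule finds the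
    least [t] for which some color of the level is not blocked and uses that
    color. This [t] is the rank of the point. As blocking is only tolerated
    below strength [k-1], no monochromatic wedge ever reaches [k] points, and
    it remains to show that high levels are reached late: a point of rank [t]
    forces at least [2^(t+1) - 1] points to be present.

    Suppose that [q] arrives with rank [t > 0]. Then all four colors of the
    level of [t-1] are blocked, by four wedges around [q] whose sets of earlier
    points are nonempty and pairwise disjoint. So no wedge contains another:
    from left to right they get lower. A point of one of the two middle wedges
    avoids the wedge on the left, hence lies to the right of [q], and the one
    on the right, hence lies above [q] ([middle_wedges]). In each middle wedge
    take the point that arrived last. On its arrival its own color was already
    blocked almost as strongly, so its rank is at least [t-1]
    ([last_in_wedge]). Moreover, no later point lies strictly below it, as that
    point would be in the wedge too ([rank_doubling]).

    Give a point of rank [t] the weight [2^(t+1) - 1] as long as no later point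
    is strictly below it. When [q] arrives, the two points found above lose
    weights of at least [2^t - 1] each, and [q] brings [2^(t+1) - 1], so the
    total weight grows by at most one per arrival and never exceeds the number
    of points ([exposed_weight_le]). This replaces the count of nodes in a
    binary tree of height [t], in which the two points would be the children
    of [q]. With fewer than [2^((k-1)m+1) - 1] points every rank is thus below
    [(k-1)m], and only the first [m] levels, that is, [4m] colors, occur.
    Finally, the ceiling of [(c-3)/4] is the floor of [c/4], so
    [4m <= c]. *)

(** * A binary doubling bound *)

Section Doubling.

Local Open Scope nat_scope.

Variables (T : Type) (below : rel T) (p : nat -> T) (t : nat -> nat).

Definition exposed (n j : nat) : bool :=
  all (fun i => ~~ below (p i) (p j)) (index_iota j.+1 n).

Lemma exposedP n j :
  reflect (forall i, j < i < n -> ~~ below (p i) (p j)) (exposed n j).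
Proof.
apply: (iffP allP) => H i; last by rewrite mem_index_iota; apply: H.
by move=> ij; apply: H; rewrite mem_index_iota.
Qed.

Lemma exposedS n j :
  j < n -> exposed n.+1 j = exposed n j && ~~ below (p n) (p j).
Proof.
by move=> jn; rewrite /exposed /index_iota subSn // -[(n - _).+1]addn1 iotaD
  all_cat /= subnKC // andbT.
Qed.

Lemma exposed_last n : exposed n.+1 n.
Proof. by apply/exposedP => i /andP[ni]; rewrite ltnS leqNgt ni. Qed.

(** The term [n] covers two terms that were exposed until then and whose ranks
    are smaller than its own by at most one. *)
Hypothesis doubling : forall n, 0 < t n -> exists j1 j2,
  j1 != j2 /\ forall j, j \in [:: j1; j2] ->
    [/\ j < n, exposed n j, below (p n) (p j) & (t n).-1 <= t j].

(** Passing from [n] to [n.+1] adds the weight [2 ^ (t n).+1 - 1] of the new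
    term and removes those of [j1] and [j2], which are at least [2 ^ t n - 1]
    each, so the total grows by at most one. *)
Lemma exposed_weight_le n :
  \sum_(0 <= j < n | exposed n j) (2 ^ (t j).+1).-1 <= n.
Proof.
elim: n => [|n IHn]; first by rewrite big_geq.
rewrite big_mkcond big_nat_recr //= exposed_last.
set w := fun j => (2 ^ (t j).+1).-1.
have wS j : (w j).+1 = 2 ^ (t j).+1 by rewrite prednK // expn_gt0.
pose kept j := if exposed n j && ~~ below (p n) (p j) then w j else 0.
have -> : \sum_(0 <= i < n) (if exposed n.+1 i then w i else 0)
          = \sum_(0 <= i < n) kept i.
  by apply: eq_big_nat => i /andP[_ lin]; rewrite exposedS.
suff: \sum_(0 <= i < n) kept i + w n
      <= (\sum_(0 <= i < n | exposed n i) w i).+1.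
  by move/leq_trans; apply; rewrite ltnS.
have [tn0|tn_gt0] := posnP (t n).
  have -> : w n = 1 by rewrite /w tn0.
  rewrite addn1 ltnS [leqRHS]big_mkcond /=; apply: leq_sum => i _.
  by rewrite /kept; case: (exposed n i) => //=; case: ifP.
have [j1 [j2 [j12 Hj]]] := doubling tn_gt0.
have [j1n e1 b1 t1] := Hj j1 (mem_head _ _).
have [j2n e2 b2 t2] : [/\ j2 < n, exposed n j2, below (p n) (p j2)
    & (t n).-1 <= t j2] by apply: Hj; rewrite !inE eqxx orbT.
have wj j : (t n).-1 <= t j -> 2 ^ t n <= (w j).+1.
  by move=> tj; rewrite wS leq_exp2l //; lia.
have wn : (w n).+1 = 2 ^ t n + 2 ^ t n by rewrite wS expnS mul2n addnn.
suff: \sum_(0 <= i < n) kept i + w j1 + w j2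
      <= \sum_(0 <= i < n | exposed n i) w i.
  by move: (wj _ t1) (wj _ t2) wn; lia.
rewrite !big_mkord [leqRHS](bigD1 (Ordinal j1n)) //=.
rewrite [X in _ <= _ + X](bigD1 (Ordinal j2n)) /=; last first.
  by rewrite e2 -val_eqE /= eq_sym.
rewrite -addnA addnC -addnA !leq_add2l [leqRHS]big_mkcond /=.
apply: leq_sum => i _; rewrite /kept -!val_eqE /=.
case: (exposed n i) => //=.
have [ij1|_] := eqVneq (nat_of_ord i) j1; first by rewrite ij1 b1.
have [ij2|_] := eqVneq (nat_of_ord i) j2; first by rewrite ij2 b2.
by case: ifP.
Qed.

(** The term [n] is exposed at time [n.+1], so its weight alone obeys the bound
    on the total. *)
Lemma doubling_bound n : 2 ^ (t n).+1 <= n.+2.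
Proof.
have := exposed_weight_le n.+1.
rewrite big_mkcond big_nat_recr //= exposed_last.
have := expn_gt0 2 (t n).+1; lia.
Qed.

End Doubling.

(** * Monochromatic wedges *)

Section Rule.

Variable R : realType.
Implicit Types (h : colored_points R) (q : plane R) (a : nat).

Definition mono (x0 y0 : \bar R) a h : bool :=
  all (fun z => wedge x0 y0 z.1 ==> (z.2 == a)) h.

Definition wcount (x0 y0 : \bar R) h : nat :=
  count (fun z => wedge x0 y0 z.1) h.

Definition strictly_below (q r : plane R) : bool := (q.1 < r.1) && (q.2 < r.2).

Lemma wedge_below (x0 y0 : \bar R) q r :
  strictly_below q r -> wedge x0 y0 r -> wedge x0 y0 q.
Proof.
move=> /andP[qr1 qr2] /andP[rx ry]; apply/andP; split.
  by apply: lt_trans rx; rewrite lte_fin.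
by apply: lt_trans ry; rewrite lte_fin.
Qed.

Definition crowded h q a (s : nat) : Prop := exists x0 y0 : \bar R,
  [/\ wedge x0 y0 q, mono x0 y0 a h & (s < wcount x0 y0 h)%N].

(** Two wedges with different colors share no point of [h], so neither apex
    dominates the other and the four wedges form a staircase. The two wedges
    other than the leftmost [l] and the lowest [r] are the middle ones. A point
    in a middle wedge is lower than the top of wedge [l] but outside it, so it
    lies to the right of that wedge, hence of [q]; symmetrically for [r]. *)
Lemma middle_wedges h q (C : 'I_4 -> nat) (X Y : 'I_4 -> \bar R) :
  injective C ->
  (forall i, [/\ wedge (X i) (Y i) q, mono (X i) (Y i) (C i) h
     & (0 < wcount (X i) (Y i) h)%N]) ->
  exists i1 i2, i1 != i2 /\ forall i, i \in [:: i1; i2] ->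
    forall z, z \in h -> wedge (X i) (Y i) z.1 -> strictly_below q z.1.
Proof.
move=> injC HW.
have sep i j : i != j -> (X j <= X i)%E -> (Y j <= Y i)%E -> False.
  move=> ij Xji Yji; have [_ _] := HW j.
  rewrite -has_count => /hasP[z zh /andP[zX zY]].
  have [_ /allP/(_ z zh) + _] := HW j; have [_ /allP/(_ z zh) + _] := HW i.
  rewrite /wedge zX zY (lt_le_trans zX Xji) (lt_le_trans zY Yji) /=.
  by move=> /eqP -> /eqP /injC /eqP; rewrite (negbTE ij).
have lower_of i j : i != j -> (X j <= X i)%E -> (Y i < Y j)%E.
  by move=> ij Xji; rewrite ltNge; apply/negP => /(sep _ _ ij Xji).
have left_of i j : i != j -> (Y j <= Y i)%E -> (X i < X j)%E.
  by move=> ij Yji; rewrite ltNge; apply/negP => /sep; apply.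
have [l _ minl] := @Order.TotalTheory.arg_minP _ _ _ ord0 xpredT X isT.
have [r _ minr] := @Order.TotalTheory.arg_minP _ _ _ ord0 xpredT Y isT.
have : (1 < #|~: [set l; r]|)%N.
  have := cardsC [set l; r]; rewrite card_ord cards2.
  by case: (l != r) => /=; lia.
case/card_gt1P => i1 [i2 [i1m i2m i12]]; exists i1, i2; split=> // i ii z zh.
have {i1m i2m ii} : i \notin [set l; r].
  by move: ii i1m i2m; rewrite !inE => /orP[] /eqP ->.
rewrite !inE negb_or => /andP[il ir] /andP[zX zY].
have Yl := lower_of _ _ il (minl i isT).
have Xr := left_of _ _ ir (minr i isT).
have neq j : j != i -> ~~ wedge (X j) (Y j) z.1.
  move=> ji; apply/negP => zj.
  have [_ /allP/(_ z zh) + _] := HW j; have [_ /allP/(_ z zh) + _] := HW i.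
  rewrite zj /wedge zX zY /= => /eqP -> /eqP /injC /eqP.
  by rewrite eq_sym (negbTE ji).
have := neq l; rewrite eq_sym il /wedge (lt_trans zY Yl) andbT => /(_ isT).
have := neq r; rewrite eq_sym ir /wedge (lt_trans zX Xr) andTb => /(_ isT).
rewrite -!leNgt => rz lz.
have [/andP[ql _] _ _] := HW l; have [/andP[_ qr] _ _] := HW r.
by rewrite /strictly_below -!lte_fin (lt_le_trans ql lz) (lt_le_trans qr rz).
Qed.

(** * The online rule and its ranks *)

Section FixedK.

(** The modulus [K.+1] is [k - 1] for [k >= 2]; written as a successor it is
    positive, so that a rank divides into level and strength. *)
Variable K : nat.

Definition level_color (t : nat) (i : 'I_4) : nat := (4 * (t %/ K.+1) + i).+1.

Definition admissible h q (t : nat) : bool :=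
  [exists i : 'I_4, `[< ~ crowded h q (level_color t i) (t %% K.+1) >]].

Lemma admissible_ex h q : exists t, admissible h q t.
Proof.
pose N := (\max_(z <- h) z.2)%N.
(* Level [N] contains only colors that do not occur in [h]. *)
exists (N * K.+1)%N; apply/existsP; exists ord0; apply/asboolP.
case=> [x0 [y0 [_ /allP m]]]; rewrite modnMl -has_count => /hasP[z zh wz].
have := m z zh; rewrite wz /level_color mulnK //= => /eqP za.
have : (z.2 <= N)%N by apply: (leq_bigmax_seq (F := fun z => z.2)).
by rewrite za; lia.
Qed.

Definition rank h q : nat := ex_minn (admissible_ex h q).

Definition rule : online_rule R := fun h q =>
  level_color (rank h q) (odflt ord0
    [pick i | `[< ~ crowded h q (level_color (rank h q) i)
                      (rank h q %% K.+1) >]]).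

Lemma ruleP h q : exists2 i, rule h q = level_color (rank h q) i
  & ~ crowded h q (rule h q) (rank h q %% K.+1).
Proof.
rewrite /rule; case: pickP => [i /asboolP|] /=; first by exists i.
have : admissible h q (rank h q) by rewrite /rank; case: ex_minnP.
by case/existsP => i + /(_ i) => ->.
Qed.

(** The rank is minimal, so its predecessor is not admissible. *)
Lemma crowded_pred_rank h q (i : 'I_4) : (0 < rank h q)%N ->
  crowded h q (level_color (rank h q).-1 i) ((rank h q).-1 %% K.+1).
Proof.
move=> t0; apply: contrapT => Hn.
have : admissible h q (rank h q).-1 by apply/existsP; exists i; apply/asboolP.
move: t0; rewrite /rank; case: ex_minnP => t _ min_t t0 /min_t; lia.
Qed.

Lemma level_color_inj t : injective (level_color t).
Proof. by move=> i j /succn_inj /addnI /val_inj. Qed.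

Lemma divn_level_color t i : ((level_color t i).-1 %/ 4 = t %/ K.+1)%N.
Proof.
by rewrite /level_color /= mulnC divnMDl // (divn_small (ltn_ord i)) addn0.
Qed.

Section Sequence.

Variable p : nat -> plane R.

Definition hist n : colored_points R := run rule (mkseq p n).
Definition color n : nat := rule (hist n) (p n).
Definition rk n : nat := rank (hist n) (p n).

Lemma histS n : hist n.+1 = rcons (hist n) (p n, color n).
Proof. by rewrite /hist /run mkseqS foldl_rcons. Qed.

Lemma hist_mkseq n : hist n = mkseq (fun i => (p i, color i)) n.
Proof. by elim: n => // n IHn; rewrite histS IHn mkseqS. Qed.

(** At the arrival of the last point [j] of a monochromatic wedge, the wedge
    already held at least [s] points of the color that [j] received. The rule
    accepts this only if the strength allowed by the rank of [j] is at least
    [s]. *)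
Lemma last_in_wedge n (x0 y0 : \bar R) a s :
  mono x0 y0 a (hist n) -> (s < wcount x0 y0 (hist n))%N ->
  exists j, [/\ (j < n)%N, wedge x0 y0 (p j),
    (forall i, (j < i < n)%N -> ~~ wedge x0 y0 (p i)),
    color j = a & (s <= rk j %% K.+1)%N].
Proof.
elim: n => [|n IHn]; first by rewrite hist_mkseq.
rewrite histS /mono /wcount all_rcons -cats1 count_cat /= addn0.
case/andP=> an mn; have [wn|wn] := boolP (wedge x0 y0 (p n)); last first.
  rewrite addn0 => sn; have [j [jn wj last_j cj sj]] := IHn mn sn.
  exists j; split=> // [|i]; first exact: ltnW.
  rewrite ltnS => /andP[ji]; rewrite leq_eqVlt => /predU1P[-> //|lin].
  by apply: last_j; rewrite ji.
rewrite addn1 ltnS => sn; move: an; rewrite wn => /eqP /= cn.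
exists n; split=> // [i /andP[ni]|]; first by rewrite ltnS leqNgt ni.
have [_ _ nc] := ruleP (hist n) (p n).
rewrite leqNgt; apply/negP => sr; apply: nc; exists x0, y0.
by split=> //; [rewrite -/(color n) cn | apply: leq_trans sn].
Qed.

Lemma color_rk n : exists i, color n = level_color (rk n) i.
Proof. by have [i] := ruleP (hist n) (p n); exists i. Qed.

(** The two witnesses are the last arrivals in the two middle wedges among the
    four that block the level of [(rk n).-1]. A later point strictly below such
    a witness would be in its wedge, so the witness is exposed. Its rank has
    the level of [(rk n).-1], since its color has, and at least its strength. *)
Lemma rank_doubling n : (0 < rk n)%N -> exists j1 j2, j1 != j2 /\
  forall j, j \in [:: j1; j2] ->
    [/\ (j < n)%N, exposed strictly_below p n j, strictly_below (p n) (p j)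
      & ((rk n).-1 <= rk j)%N].
Proof.
move=> t0; set t := (rk n).-1.
have /choice[X /choice[Y HW]] := fun i => crowded_pred_rank i t0.
have [|i1 [i2 [i12 mid]]] :=
    @middle_wedges (hist n) (p n) (level_color t) X Y (@level_color_inj t).
  by move=> i; have [wq m c] := HW i; split=> //; apply: leq_trans c.
have /choice[J HJ] := fun i => let: And3 _ m c := HW i in last_in_wedge m c.
exists (J i1), (J i2); split.
  apply: contra i12 => /eqP J12; apply/eqP/(@level_color_inj t).
  by have [_ _ _ <- _] := HJ i1; have [_ _ _ <- _] := HJ i2; rewrite J12.
move=> j; rewrite !inE => jJ.
have [i ii ->] : exists2 i, i \in [:: i1; i2] & j = J i.
  by case/orP: jJ => /eqP ->; [exists i1 | exists i2];
    rewrite // !inE eqxx ?orbT.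
have [jn wj last_j cj sj] := HJ i; split=> //.
- apply/exposedP => l jl; apply: contra (last_j l jl) => lj.
  exact: wedge_below lj wj.
- apply: (mid i ii (p (J i), color (J i)) _ wj).
  by rewrite hist_mkseq; apply/mapP; exists (J i); rewrite // mem_iota.
- have [i' ci'] := color_rk (J i).
  have : (rk (J i) %/ K.+1 = t %/ K.+1)%N.
    by rewrite -(divn_level_color _ i') -ci' cj divn_level_color.
  move=> lev; rewrite (divn_eq t K.+1) (divn_eq (rk (J i)) K.+1) lev.
  by rewrite leq_add2l.
Qed.

Lemma color_le m n j : (n.+1 < 2 ^ (K.+1 * m).+1)%N -> (j < n)%N ->
  (1 <= color j <= 4 * m)%N.
Proof.
move=> nm jn; have [i ->] := color_rk j.
have := leq_ltn_trans (leq_trans (doubling_bound rank_doubling j) _) nm.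
rewrite !ltnS ltn_exp2l // ltnS => /(_ jn).
rewrite mulnC -ltn_divLR // /level_color => lt_m.
by move: (ltn_ord i) lt_m; move: (_ %/ _)%N (nat_of_ord i) => q r; lia.
Qed.

(** In a monochromatic wedge with [K.+2] points the last arrival would have
    strength at least [K.+1], but strengths are remainders modulo [K.+1]. *)
Lemma wedge_two_colors n (x0 y0 : \bar R) :
  (K.+2 <= wcount x0 y0 (hist n))%N ->
  exists z1 z2, [/\ z1 \in hist n, z2 \in hist n,
    wedge x0 y0 z1.1, wedge x0 y0 z2.1 & z1.2 != z2.2].
Proof.
move=> big; have : has (fun z => wedge x0 y0 z.1) (hist n).
  by rewrite has_count; apply: leq_trans big.
case/hasP=> z1 z1h wz1; have [m|] := boolP (mono x0 y0 z1.2 (hist n)).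
  have [j [_ _ _ _]] := last_in_wedge m big.
  by rewrite leqNgt ltn_pmod.
case/allPn=> z2 z2h; rewrite negb_imply => /andP[wz2 ne].
by exists z1, z2; rewrite eq_sym.
Qed.

End Sequence.

End FixedK.

End Rule.

(** * The threshold *)

Lemma ceil_quarter (c : nat) :
  Num.ceil ((c%:R - 3) / 4 : rat) = (c %/ 4)%N%:Z.
Proof.
apply: ceil_def.
have cE : (c%:R : rat) = (c %/ 4)%N%:R * 4 + (c %% 4)%N%:R.
  by rewrite {1}(divn_eq c 4) natrD natrM.
have r3 : ((c %% 4)%N%:R : rat) <= 3 by rewrite (ler_nat _ _ 3) -ltnS ltn_pmod.
have r0 := ler0n rat (c %% 4).
by rewrite cE intrB -!pmulrn; lra.
Qed.

Lemma threshold (k c n : nat) : (0 < k)%N ->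
  (n%:R : rat) < 2 ^ ((k%:Z - 1) * Num.ceil ((c%:R - 3) / 4 : rat) + 1) - 1 ->
  (n.+1 < 2 ^ (k.-1 * (c %/ 4)).+1)%N.
Proof.
case: k => // k _; rewrite ceil_quarter.
have -> : (k.+1%:Z - 1) * (c %/ 4)%N%:Z + 1 = (k * (c %/ 4)).+1%:Z.
  by rewrite -addn1 PoszD addrK -PoszM -PoszD addn1.
rewrite -exprnP ltrBrDr -natrX.
by rewrite -(natrD _ n 1) ltr_nat addn1.
Qed.

Theorem theorem8 (R : realType) (k : nat) (hk : (1 <= k)%N) :
  exists A : online_rule R,
    (forall h q, (1 <= A h q)%N) /\
    forall (L : option nat) (p : nat -> plane R), distinct_points L p ->
    forall c n : nat, (1 <= c)%N ->
      (forall i, (i < n)%N -> in_length L i) ->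
      (n%:R : rat) <
        2 ^ ((k%:Z - 1) * Num.ceil ((c%:R - 3) / 4 : rat) + 1) - 1 ->
      properly_colored k c (run A (mkseq p n)) /\
      (forall z, z \in run A (mkseq p n) -> (1 <= z.2 <= c)%N).
Proof.
exists (rule k.-2); split=> [h q|L p _ c n _ _ /(threshold hk)].
  by have [i ->] := ruleP k.-2 h q.
case: k hk => [|[|K]] // _.
  (* For [k = 1] the bound leaves only the empty sequence. *)
  by rewrite mul0n; case: n.
move=> /= nc; have col z : z \in hist K p n -> (1 <= z.2 <= c)%N.
  rewrite hist_mkseq => /mapP[j]; rewrite mem_iota => /andP[_ jn] -> /=.
  have := color_le p nc jn; have := leq_trunc_div c 4; lia.
split=> //; split; last by move=> x0 y0 _ _; apply: wedge_two_colors.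
rewrite -[leqRHS](size_iota 1); apply: uniq_leq_size (undup_uniq _) _ => a.
by rewrite mem_undup => /mapP[z /col zc ->]; rewrite mem_iota add1n ltnS.
Qed.
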